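(* Consider the gap-observation bandit problem described in the context, with $K$ arms and horizon $T$, and let $M\in\mathbb N^*$ and $B^*>0$. Assume: (i) the observations $(X_{k,t})_{k\in[K],t\in[T]}$ are independent across arms and across time, satisfy $-X_{k,t}\in[0,1]$ and $\mathbb E X_{k,t}=-\Delta_k(t)$; (ii) there exist integers $1=\bar\tau_1<\dots<\bar\tau_M<\bar\tau_{M+1}=T+1$ such that for every $k\in[K]$, every $m\in\{1,\dots,M\}$ and all $t,t'\in[\bar\tau_m,\bar\tau_{m+1})\cap\mathbb N$, either $2^{-1/4}\le\Delta_k(t)/\Delta_k(t')\le2^{1/4}$ or $\Delta_k(t)\in[0,2(T^{-1/2}\lor B^* )]$. Then the expected regret of SelectiveBandits run with parameter $B^*$ satisfies, for any $c\ge16$, $$\mathbb E R^{(\mathrm{gap})}_T\le\{2^{3/2}+2^{1/2}c\log(2KT^3)\}\sqrt{KTM}+2KM+8T(B^*\lor T^{-1/2})+1.$$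
   Context: Setting (gap observations). There are $K$ arms $[K]$ and $T$ time steps. Arm $k$ at time $t$ has mean $\mu_k(t)=f_k(t/T)$ for an unknown $f_k$ on $[0,1]$; let $\mu^*(t)=\max_k\mu_k(t)$ and $\Delta_k(t)=\mu^*(t)-\mu_k(t)$. The observation for arm $k$ at time $t$ is $X_{k,t}=-\Delta_k(t)+\epsilon^{(k)}_t$. At each time $t$ the learner chooses an arm $k_t$ (based on past observations) and observes only $X_{k_t,t}$. The regret is $R^{(\mathrm{gap})}_T=-\mathbb E\sum_{t=1}^TX_{k_t,t}=\mathbb E\sum_{t=1}^T\Delta_{k_t}(t)$. Algorithm SelectiveBandits (parameter $B^*$). Time is divided into rounds $r=1,2,\dots$ with active sets $K_r\subset[K]$; if $K_r\ne\emptyset$, every arm of $K_r$ is pulled once in increasing order of index (the pull of $k$ in round $r$ yields $\tilde X_r(k)$); the algorithm stops when the budget $T$ is exhausted. The current episode started at round $\rho$ (initially $\rho=1$, and $K_1=[K]$). For rounds $r'<r$ let $T_k(r',r)=\sum_{j=r'}^{r-1}\mathbf 1\{k\in K_j\}$, $\hat\Delta_k(r',r)=-\frac{1}{T_k(r',r)}\sum_{j=r'}^{r-1}\tilde X_j(k)\mathbf 1\{k\in K_j\}$ (or $0$ if $T_k(r',r)=0$), and $\tilde\Delta_k(r',r)=\{\hat\Delta_k(r',r)-\sqrt{\log(2KT^3)/(2T_k(r',r))}-2(T^{-1/2}\lor B^* )\}\lor0$ (or $0$ if $T_k(r',r)=0$). For $r>1$, $K_r=\{k\in[K]:\tilde\Delta_k(\rho,r')=0\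 \text{for all}\ \rho\le r'\le r\}$. If $K_r=\emptyset$, no arm is pulled in round $r$, a new episode starts with $\rho=r$ (so all arms become active again, since no data from the new episode has been collected). *)

(* Defs.v *)
From HB Require Import structures.
From mathcomp Require Import all_boot all_order all_algebra.
From mathcomp Require Import all_classical all_reals all_analysis.
Set Implicit Arguments. Unset Strict Implicit. Unset Printing Implicit Defensive.
Import Order.TTheory GRing.Theory Num.Theory.
Local Open Scope classical_set_scope.
Local Open Scope ring_scope.

Section Bandit.
Variable R : realType.

(* Means and gaps.  f k is the unknown function on [0,1]; mu_k(t)=f_k(t/T). *)
Definition mu (K T : nat) (f : 'I_K -> R -> R) (k : 'I_K) (t : nat) : R :=
  f k (t%:R / T%:R).

Definition mustar (K T : nat) (f : 'I_K -> R -> R) (t : nat) : R :=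
  fine (\big[Order.max/-oo%E]_(k < K) (mu T f k t)%:E).

Definition gap (K T : nat) (f : 'I_K -> R -> R) (k : 'I_K) (t : nat) : R :=
  mustar T f t - mu T f k t.

(* A round record: rd k = Some x iff arm k was pulled in that round,    *)
(* with observation x = \tilde X_r(k).                                 *)
Definition round_obs (K : nat) := 'I_K -> option R.

Definition empty_round (K : nat) : round_obs K := fun _ => None.

(* T_k(rho, r') where hist = rounds rho .. r'-1 *)
Definition Tk (K : nat) (hist : seq (round_obs K)) (k : 'I_K) : nat :=
  count (fun rd : round_obs K => isSome (rd k)) hist.

Definition obs_val (o : option R) : R := if o is Some x then x else 0.

Definition hatDelta (K : nat) (hist : seq (round_obs K)) (k : 'I_K) : R :=
  if Tk hist k == 0%N then 0
  else - ((\sum_(rd <- hist) obs_val (rd k)) / (Tk hist k)%:R).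

Definition tildeDelta (K T : nat) (Bstar : R) (hist : seq (round_obs K))
  (k : 'I_K) : R :=
  if Tk hist k == 0%N then 0
  else Num.max (hatDelta hist k
                - Num.sqrt (ln (2 * K%:R * (T%:R ^+ 3)) / (2 * (Tk hist k)%:R))
                - 2 * Num.max (Num.sqrt T%:R)^-1 Bstar) 0.

(* K_r, where hist = rounds rho .. r-1 of the current episode:
   k is active iff tildeDelta(rho, r') = 0 for every rho <= r' <= r,
   i.e. for every prefix of hist of length 0 .. size hist. *)
Definition active (K T : nat) (Bstar : R) (hist : seq (round_obs K)) : seq 'I_K :=
  [seq k <- enum 'I_K |
    all (fun j => tildeDelta T Bstar (take j hist) k == 0) (iota 0 (size hist).+1)].

(* State between time steps:
   hist = completed rounds of the current episode (rounds rho .. r-1),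
   cur  = observations of the current round r so far,
   rem  = arms of K_r still to be pulled in round r (increasing order). *)
Record sb_state (K : nat) := SBState {
  sb_hist : seq (round_obs K);
  sb_cur  : round_obs K;
  sb_rem  : seq 'I_K }.

Definition sb_init (K : nat) : sb_state K :=
  SBState [::] (@empty_round K) (enum 'I_K).

(* Given the start of a time step with no arm left in the current round:
   close the current round, compute K_{r+1}; if empty, that round pulls no
   arm and a new episode starts at it (its history is that empty round),
   and the following round's active set is computed. *)
Definition new_round (K T : nat) (Bstar : R) (s : sb_state K)
  : seq (round_obs K) * seq 'I_K :=
  let hist1 := rcons (sb_hist s) (sb_cur s) in
  let A := active T Bstar hist1 in
  if A is [::] then
    let hist2 := [:: @empty_round K] in (hist2, active T Bstar hist2)
  else (hist1, A).

(* One time step t with observation table x (x k t = X_{k,t}); only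
   x k t for the pulled arm k is read.  Returns the pulled arm. *)
Definition sb_step (K T : nat) (Bstar : R) (x : 'I_K -> nat -> R) (t : nat)
  (s : sb_state K) : option 'I_K * sb_state K :=
  let '(hist, rem) :=
    if sb_rem s is [::] then new_round T Bstar s else (sb_hist s, sb_rem s) in
  let cur := if sb_rem s is [::] then @empty_round K else sb_cur s in
  match rem with
  | [::] => (None, SBState hist cur [::])
  | k :: rem' =>
      (Some k, SBState hist
                 (fun j => if j == k then Some (x k t) else cur j) rem')
  end.

Fixpoint sb_state_after (K T : nat) (Bstar : R) (x : 'I_K -> nat -> R) (n : nat)
  : sb_state K :=
  match n with
  | 0 => sb_init K
  | n'.+1 => (sb_step T Bstar x n (sb_state_after T Bstar x n')).2
  end.

Definition sb_arm (K T : nat) (Bstar : R) (x : 'I_K -> nat -> R) (t : nat)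
  : option 'I_K :=
  (sb_step T Bstar x t (sb_state_after T Bstar x t.-1)).1.

Definition sb_regret (K T : nat) (f : 'I_K -> R -> R) (Bstar : R)
  (x : 'I_K -> nat -> R) : R :=
  \sum_(1 <= t < T.+1)
    (if sb_arm T Bstar x t is Some k then gap T f k t else 0).

Definition mutually_independent (d : measure_display) (Omega : measurableType d)
  (P : probability Omega R) (I : finType) (Y : I -> Omega -> R) : Prop :=
  forall (J : {set I}) (B : I -> set R),
    (forall i, measurable (B i)) ->
    P (\big[setI/setT]_(i in J) (Y i @^-1` B i)) =
    (\prod_(i in J) P (Y i @^-1` B i))%E.

End Bandit.

(* Main.v *)
Require Import Defs.
From HB Require Import structures.
From mathcomp Require Import all_boot all_order all_algebra.
From mathcomp Require Import all_classical all_reals all_analysis.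
From mathcomp Require Import measurable_realfun giry zify ring lra.
Set Implicit Arguments. Unset Strict Implicit. Unset Printing Implicit Defensive.
Import Order.TTheory GRing.Theory Num.Theory.
Local Open Scope classical_set_scope.
Local Open Scope ring_scope.
Import numFieldNormedType.Exports.

(* Write Y = -X for the losses, L = ln (2 K T^3) and th = max (T^(-1/2)) B.
   Whether time t is one of the first n pulls of arm k after time a is decided
   by the observations made before t, so the exponential process
   prod exp (l (Y - gap) - l^2 / 8) over these times is a supermartingale by
   Hoeffding's lemma.  A union bound over k, a, n and the two signs shows that
   off an event of probability at most 1/T, every window containing n pulls of
   an arm has |sum Y - sum gap| <= sqrt (n L / 2).

   On the good event an arm is eliminated only if its average gap since the
   start of the episode exceeds 2 th.  Within one segment the arm that is
   optimal at some time keeps its gap below 2 th, so an episode that ends has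
   crossed a breakpoint, and there are at most M episodes.  An arm pulled n
   times in an episode was not eliminated before its last pull, so it costs
   at most 2 th n + 2 sqrt (n L / 2) + 1 there; this is summed over the at most
   K M pairs of an arm and an episode. *)

(** * Independence of a random variable from a generated sigma-algebra *)

Section Independence.
Local Open Scope ereal_scope.
Context (R : realType) (d : measure_display) (Omega : measurableType d)
  (P : probability Omega R).
Variables (G : set (set Omega)) (Z : Omega -> R).
Hypotheses (GI : setI_closed G) (GT : G setT) (Gm : G `<=` measurable)
  (mZ : measurable_fun setT Z).
Hypothesis indep : forall A C, G A -> measurable C ->
  P (A `&` Z @^-1` C) = P A * P (Z @^-1` C).

Lemma measurable_sub_sigma : <<s G >> `<=` (@measurable _ Omega).
Proof. by apply: smallest_sub => //; exact: sigma_algebra_measurable. Qed.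

Let mZpre C : measurable C -> measurable (Z @^-1` C).
Proof. by move=> mC; rewrite -[X in measurable X]setTI; exact: mZ. Qed.

Lemma indep_sub_sigma (A : set Omega) (C : set R) : <<s G >> A ->
  measurable C -> P (A `&` Z @^-1` C) = P A * P (Z @^-1` C).
Proof.
move=> sA mC.
have C0 : (0 <= fine (P (Z @^-1` C)))%R by rewrite fine_ge0.
pose m1 := mrestr P (mZpre mC).
pose m2 := mscale (NngNum C0) P.
have PCE : (fine (P (Z @^-1` C)))%:E = P (Z @^-1` C).
  by rewrite fineK// fin_num_measure//; exact: mZpre.
have -> : P A * P (Z @^-1` C) = m2 A by rewrite muleC -[X in X * _]PCE.
rewrite -[LHS]/(m1 A).
apply: (@g_sigma_algebra_measure_unique _ _ _ G Gm (fun=> setT)) => //.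
- by rewrite bigcup_const.
- by move=> B GB; rewrite -[LHS]/(P (B `&` Z @^-1` C)) indep// muleC -[X in X * _]PCE.
- move=> _; rewrite -[X in X < _]/(P (setT `&` Z @^-1` C)) setTI ltey_eq.
  by rewrite fin_num_measure//; exact: mZpre.
Qed.

Let OG : measurableType G.-sigma := g_sigma_algebraType G.

(** By independence the law of [(w, Z w)] on [OG * R] is a product measure, and Tonelli factorises
    the integral. Measurability of [W] for [OG] says that [W] depends on the past only. *)
Lemma expectation_indepM (W : OG -> \bar R) (g : R -> \bar R) :
  measurable_fun setT W -> (forall w, 0 <= W w) ->
  measurable_fun setT g -> (forall y, 0 <= g y) ->
  \int[P]_w (W w * g (Z w)) = (\int[P]_w W w) * (\int[P]_w g (Z w)).
Proof.
move=> mW W0 mg g0.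
have mid : measurable_fun setT (id : Omega -> OG).
  by move=> _ B mB; rewrite setTI; exact: measurable_sub_sigma.
pose f : Omega -> OG * R := fun w => (w, Z w).
have mf : measurable_fun setT f by exact: measurable_fun_pair.
have push (d' : measure_display) (T' : measurableType d') (h : Omega -> T')
    (mh : measurable_fun setT h) (u : T' -> \bar R) :
    measurable_fun setT u -> (forall y, 0 <= u y) ->
    \int[giry_map mh P]_y u y = \int[P]_w u (h w).
  by move=> mu u0; exact: giry_int_map.
pose F : OG * R -> \bar R := fun p => W p.1 * g p.2.
have mF : measurable_fun setT F.
  by apply: emeasurable_funM; apply: measurableT_comp.
have F0 p : 0 <= F p by rewrite mule_ge0.
rewrite -(push _ _ f mf F mF F0).
transitivity (\int[giry_map mid P \x giry_map mZ P]_p F p).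
  apply: eq_measure_integral => A mA _; apply/esym.
  apply: product_measure_unique => // B C mB mC.
  exact: indep_sub_sigma.
rewrite fubini_tonelli1// /fubini_F /F /=.
under eq_integral do rewrite ge0_integralZl//.
rewrite (push _ _ _ mZ g mg g0).
rewrite ge0_integralZr//; last exact: integral_ge0.
by rewrite (push _ _ _ mid W mW W0).
Qed.
End Independence.

(** * Hoeffding's lemma for variables in [0, 1] *)

Section Hoeffding.
Context (R : realType).

Lemma is_derive_ge0_ge0 (f df : R -> R) : f 0 = 0 ->
  (forall x : R, is_derive x 1 f (df x)) -> (forall x, 0 <= x -> 0 <= df x) ->
  forall x, 0 <= x -> 0 <= f x.
Proof.
move=> f0 fdf df0 x x0; rewrite -f0.
apply: (@ger0_derive1_ndecr R f 0 x) => //.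
- by move=> y; rewrite in_itv /= => /andP[/ltW y0 _]; rewrite derive1E derive_val df0.
- by apply: derivable_within_continuous => y _.
Qed.

(** The logarithm [f] of the ratio of the two sides vanishes at 0 together with its derivative [df],
    and its second derivative is 1/4 - v (1 - v) = (v - 1/2)^2 >= 0; monotonicity is applied
    twice. *)
Lemma bernoulli_mgf_ge0 (p l : R) : 0 <= p <= 1 -> 0 <= l ->
  1 - p + p * expR l <= expR (l * p + l ^+ 2 / 8).
Proof.
move=> /andP[p0 p1] l0.
pose u (x : R) : R := 1 - p + p * expR x.
have u_gt0 x : 0 < u x.
  have := expR_gt0 x; rewrite /u; move: p0; rewrite le_eqVlt => /predU1P[<-|p0] e0.
    by lra.
  by have := mulr_gt0 p0 e0; lra.
pose df (x : R) : R := p + x / 4 - p * expR x / u x.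
have udf (x : R) : is_derive x 1 u (p * expR x).
  by apply: is_derive_eq; rewrite /GRing.scale/=; ring.
have ddf (x : R) : is_derive x 1 df (4^-1 - (p * expR x / u x) * (1 - p * expR x / u x)).
  have ui : is_derive x 1 (fun y => (u y)^-1) (- (u x) ^- 2 *: (p * expR x)).
    by apply: is_deriveV; rewrite ?gt_eqF.
  rewrite /df; apply: is_derive_eq; rewrite /GRing.scale/=.
  by field; rewrite gt_eqF.
have df0 x : 0 <= x -> 0 <= df x.
  apply: (is_derive_ge0_ge0 _ ddf).
    by rewrite /df /u expR0; field; rewrite subrK oner_eq0.
  move=> y _; set v := _ / u y.
  by have := sqr_ge0 (v - 2^-1); rewrite expr2; lra.
pose f (x : R) : R := x * p + x ^+ 2 / 8 - ln (u x).
have fdf (x : R) : is_derive x 1 f (df x).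
  have lnu : is_derive x 1 (@ln R \o u) ((u x)^-1 * (p * expR x)).
    by apply: is_derive1_comp; exact: is_derive1_ln.
  rewrite /f; apply: is_derive_eq; rewrite /GRing.scale/= /df.
  by field; rewrite gt_eqF.
have := is_derive_ge0_ge0 _ fdf df0 l0; rewrite /f.
have -> : 0 * p + 0 ^+ 2 / 8 - ln (u 0) = 0.
  by rewrite /u expR0 mulr1 subrK ln1; ring.
move=> /(_ erefl); rewrite subr_ge0 => le_ln.
rewrite -(ler_expR (ln _)) lnK ?posrE// in le_ln.
Qed.

Lemma bernoulli_mgf (p l : R) : 0 <= p <= 1 ->
  1 - p + p * expR l <= expR (l * p + l ^+ 2 / 8).
Proof.
move=> p01; have [l0|l0] := leP 0 l; first exact: bernoulli_mgf_ge0.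
(* Exchanging the two outcomes turns [(p, l)] into [(1 - p, - l)], at the price of a factor
   [expR l]. *)
have q01 : 0 <= 1 - p <= 1 by lra.
have Nl0 : 0 <= - l by lra.
have := bernoulli_mgf_ge0 q01 Nl0 => le.
have -> : 1 - p + p * expR l = expR l * (1 - (1 - p) + (1 - p) * expR (- l)).
  by have := expRxMexpNx_1 l; set a := expR l; set b := expR _; nra.
have -> : l * p + l ^+ 2 / 8 = l + (- l * (1 - p) + (- l) ^+ 2 / 8) by field.
by rewrite expRD ler_pM2l ?expR_gt0.
Qed.

Lemma expR_chord (l y : R) : 0 <= y <= 1 -> expR (l * y) <= 1 - y + y * expR l.
Proof.
move=> /andP[y0 y1].
have := @convex_expR R (Itv01 y0 y1) l 0.
by rewrite !convRE /= /unstable.onem expR0 mulr0 mulr1 addr0 mulrC addrC.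
Qed.

Lemma integral_cst_probability (d : measure_display)
    (Omega : measurableType d) (P : probability Omega R) (r : R) :
  (\int[P]_w r%:E = r%:E)%E.
Proof. by have := expectation_cst P r; rewrite unlock. Qed.

Lemma integral_01 (d : measure_display) (Omega : measurableType d)
    (P : probability Omega R) (Y : Omega -> R) (m : R) :
  measurable_fun setT Y -> (forall w, 0 <= Y w <= 1) ->
  (\int[P]_w (Y w)%:E = m%:E)%E -> 0 <= m <= 1.
Proof.
move=> mY Y01 EY; rewrite -!lee_fin -EY.
have Y0 w : (0 <= (Y w)%:E)%E by rewrite lee_fin; case/andP: (Y01 w).
apply/andP; split; first by apply: integral_ge0 => w _.
rewrite -(integral_cst_probability P); apply: ge0_le_integral => //.
- exact/measurable_EFinP.
- by move=> w _; rewrite lee_fin; case/andP: (Y01 w).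
Qed.

(** Bounding the exponential by its chord on [0, 1] makes the integrand affine in [Y], which reduces
    the claim to a Bernoulli variable of mean [m]. *)
Lemma hoeffding_mgf (d : measure_display) (Omega : measurableType d)
    (P : probability Omega R) (Y : Omega -> R) (m l : R) :
  measurable_fun setT Y -> (forall w, 0 <= Y w <= 1) ->
  (\int[P]_w (Y w)%:E = m%:E)%E ->
  (\int[P]_w (expR (l * (Y w - m) - l ^+ 2 / 8))%:E <= 1)%E.
Proof.
move=> mY Y01 EY.
have Y0 w : 0 <= Y w by case/andP: (Y01 w).
have m01 := integral_01 mY Y01 EY.
pose k := expR (- (l * m) - l ^+ 2 / 8).
have k0 : 0 <= k by exact: expR_ge0.
have e0 : 0 <= expR l by exact: expR_ge0.
have c0 w : 0 <= k * (1 - Y w + Y w * expR l).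
  rewrite mulr_ge0// addr_ge0 ?mulr_ge0//.
  by rewrite subr_ge0; case/andP: (Y01 w).
apply: (@le_trans _ _ (\int[P]_w (k * (1 - Y w + Y w * expR l))%:E)%E).
  apply: ge0_le_integral => //.
  - apply/measurable_EFinP; apply: measurableT_comp => //.
    apply: measurable_funB => //; apply: measurable_funM => //.
    exact: measurable_funB.
  - apply/measurable_EFinP; apply: measurable_funM => //.
    by apply: measurable_funD; [exact: measurable_funB|exact: measurable_funM].
  - move=> w _; rewrite lee_fin.
    have -> : l * (Y w - m) - l ^+ 2 / 8 = (- (l * m) - l ^+ 2 / 8) + l * Y w.
      by field.
    by rewrite expRD ler_wpM2l// expR_chord.
have -> : (\int[P]_w (k * (1 - Y w + Y w * expR l))%:E =
    (k * (1 - m + m * expR l))%:E)%E.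
  have Yint : P.-integrable setT (EFin \o Y).
    apply/integrableP; split; first exact/measurable_EFinP.
    under eq_integral do rewrite /= ger0_norm//.
    by rewrite EY ltry.
  have -> : (fun w => (k * (1 - Y w + Y w * expR l))%:E) =
      ((fun=> k%:E) \+ (fun w => (k * (expR l - 1))%:E * (Y w)%:E))%E.
    by apply/funext => w /=; rewrite -EFinM -EFinD; congr EFin; ring.
  rewrite integralD//; last 2 first.
  - exact: finite_measure_integrable_cst.
  - exact: integrableZl.
  rewrite integral_cst_probability integralZl// EY -EFinM -EFinD.
  by congr EFin; ring.
rewrite lee_fin.
have := bernoulli_mgf l m01; rewrite -(ler_pM2l (expR_gt0 (- (l * m) - l ^+ 2 / 8))).
by move=> /le_trans; apply; rewrite -expRD [X in expR X](_ : _ = 0) ?expR0//; field.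
Qed.
End Hoeffding.

(** * Measurability of the algorithm's choices *)

Section Measurability.
Context (R : realType) (d : measure_display) (Omega : measurableType d).
Variables (K T : nat) (B : R) (x : 'I_K -> nat -> Omega -> R).
Hypothesis mx : forall k t, measurable_fun setT (x k t).

Let xw (w : Omega) : 'I_K -> nat -> R := fun k t => x k t w.

(* A skeleton is a state in which every observation is replaced by the time
   at which it was made: with the skeleton fixed, the state depends on the
   data through finitely many coordinates only. *)
Definition inst_round (X : 'I_K -> nat -> R) (rd : 'I_K -> option nat) :
  round_obs R K := fun k => omap (X k) (rd k).

Definition inst_state (X : 'I_K -> nat -> R)
    (s : seq ('I_K -> option nat) * ('I_K -> option nat) * seq 'I_K) :
  sb_state R K :=
  SBState [seq inst_round X rd | rd <- s.1.1] (inst_round X s.1.2) s.2.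

Lemma measurable_filter (b : 'I_K -> Omega -> bool) (s : seq 'I_K)
    (Q : seq 'I_K -> Omega -> Prop) :
  (forall k, measurable_fun setT (b k)) ->
  (forall A, measurable [set w | Q A w]) ->
  measurable [set w | Q [seq k <- s | b k w] w].
Proof.
move=> mb; elim: s Q => [|k s IH] Q mQ /=; first exact: mQ.
rewrite [X in measurable X](_ : _ =
  ([set w | b k w] `&` [set w | Q (k :: [seq j <- s | b j w]) w]) `|`
  (~` [set w | b k w] `&` [set w | Q [seq j <- s | b j w] w])).
  have mbk : measurable [set w | b k w].
    have := mb k measurableT [set true] I.
    by rewrite setTI; congr measurable; apply/seteqP; split => w.
  apply: measurableU; apply: measurableI => //.
  - exact: (IH (fun A w => Q (k :: A) w)).
  - exact: measurableC.
  - exact: (IH Q).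
apply/seteqP; split => w /=; case: (b k w) => //=.
- by left.
- by right.
- by case=> [[]|[]].
- by case=> [[]|[]].
Qed.

Lemma Tk_inst w h k :
  Tk [seq inst_round (xw w) rd | rd <- h] k = count (fun rd => isSome (rd k)) h.
Proof. by rewrite /Tk count_map; apply: eq_count => rd; rewrite /= /inst_round; case: (rd k). Qed.

Lemma measurable_tildeDelta h k :
  measurable_fun setT
    (fun w => tildeDelta T B [seq inst_round (xw w) rd | rd <- h] k).
Proof.
rewrite /tildeDelta /hatDelta.
have [c|/negbTE c] :=
    boolP (count (fun rd : 'I_K -> option nat => isSome (rd k)) h == 0%N).
  by under eq_fun do rewrite Tk_inst c; exact: measurable_cst.
under eq_fun do rewrite Tk_inst c.
apply: measurable_maxr => //; do 2! apply: measurable_funB => //.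
apply: measurableT_comp => //; apply: measurable_funM => //.
under eq_fun do rewrite big_map; apply: measurable_sum => rd.
by rewrite /inst_round; case: (rd k) => [t|] //=; exact: mx.
Qed.

Lemma measurable_active h (Q : seq 'I_K -> Omega -> Prop) :
  (forall A, measurable [set w | Q A w]) ->
  measurable [set w | Q (active T B [seq inst_round (xw w) rd | rd <- h]) w].
Proof.
move=> mQ; rewrite /active.
pose b k w := all (fun j => tildeDelta T B
  (take j [seq inst_round (xw w) rd | rd <- h]) k == 0) (iota 0 (size h).+1).
rewrite [X in measurable X](_ : _ =
    [set w | Q [seq k <- enum 'I_K | b k w] w]); last first.
  by apply/seteqP; split => w /=; rewrite /b size_map.
apply: measurable_filter => // k; rewrite /b.
elim: (iota _ _) => [|j s IH] //=; apply: measurable_and => //.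
under eq_fun do rewrite -map_take.
by apply: measurable_fun_eqr => //; exact: measurable_tildeDelta.
Qed.

Lemma inst_round_update w (rd : 'I_K -> option nat) k t :
  (fun j => if j == k then Some (xw w k t) else inst_round (xw w) rd j) =
  inst_round (xw w) (fun j => if j == k then Some t else rd j).
Proof. by apply/funext => j; rewrite /inst_round; case: eqP => // ->. Qed.

(** States carry no sigma-algebra, so measurability is expressed through predicates [Q]: it suffices
    to check [Q] at each skeleton. [Q] also takes [w], because an instantiated skeleton depends on
    it. *)
Lemma measurable_sb_step t s (Q : option 'I_K * sb_state R K -> Omega -> Prop) :
  (forall o s', measurable [set w | Q (o, inst_state (xw w) s') w]) ->
  measurable [set w | Q (sb_step T B (xw w) t (inst_state (xw w) s)) w].
Proof.
case: s => [[h c] [|k r]] mQ; rewrite /sb_step /=; last first.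
  rewrite [X in measurable X](_ : _ = [set w | Q (Some k, inst_state (xw w)
    (h, (fun j => if j == k then Some t else c j), r)) w]) //.
  by apply/seteqP; split => w /=; rewrite inst_round_update.
pose h1 := rcons h c.
(* The outcome of the step as a function of the active set [A], in the form required by
   [measurable_active]. *)
pose pull h' (A : seq 'I_K) w := match A with
  | [::] => (None, inst_state (xw w) (h', (fun=> None), [::]))
  | k :: r => (Some k, inst_state (xw w)
      (h', (fun j => if j == k then Some t else None), r))
  end.
pose res A w := if A is [::] then
    pull [:: (fun=> None)] (active T B [:: @empty_round R K]) w else pull h1 A w.
rewrite [X in measurable X](_ : _ = [set w |
    Q (res (active T B [seq inst_round (xw w) rd | rd <- h1]) w) w]); last first.
  congr [set w | Q _ w]; apply/funext => w.
  rewrite /new_round /= /res /h1 map_rcons.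
  case: (active T B (rcons _ _)) => [|k r] /=; last first.
    by rewrite /pull /inst_state /= -inst_round_update map_rcons.
  have -> : [:: @empty_round R K] = [seq inst_round (xw w) rd | rd <- [:: fun=> None]].
    by [].
  case: (active T B [seq _ | _ <- [:: _]]) => [|k r] //=.
  by rewrite /pull /inst_state /= -inst_round_update.
have mpull h' A : measurable [set w | Q (pull h' A w) w].
  by case: A => [|k r] /=; exact: mQ.
apply: (@measurable_active h1 (fun A w => Q (res A w) w)) => -[|k r].
  exact: (mpull [:: fun=> None]).
exact: (mpull h1 (k :: r)).
Qed.

Lemma measurable_sb_state n (Q : sb_state R K -> Omega -> Prop) :
  (forall s, measurable [set w | Q (inst_state (xw w) s) w]) ->
  measurable [set w | Q (sb_state_after T B (xw w) n) w].
Proof.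
elim: n Q => [|n IH] Q mQ /=.
  exact: (mQ ([::], (fun=> None), enum 'I_K)).
apply: (IH (fun st w => Q (sb_step T B (xw w) n.+1 st).2 w)) => s.
by apply: (@measurable_sb_step n.+1 s (fun p w => Q p.2 w)) => o s'; exact: mQ.
Qed.

Lemma measurable_sb_arm_all t k :
  measurable [set w | sb_arm T B (xw w) t = Some k].
Proof.
apply: (@measurable_sb_state t.-1
  (fun st w => (sb_step T B (xw w) t st).1 = Some k)) => s.
apply: (@measurable_sb_step t s (fun p w => p.1 = Some k)) => o s' /=.
have [->|ok] := pselect (o = Some k).
  by rewrite (_ : [set w | _] = setT)//; apply/seteqP; split.
by rewrite (_ : [set w | _] = set0)//; apply/seteqP; split.
Qed.

End Measurability.

Lemma eq_sb_state_after (R : realType) (K T : nat) (B : R)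
    (x y : 'I_K -> nat -> R) n :
  (forall k t, (1 <= t <= n)%N -> x k t = y k t) ->
  sb_state_after T B x n = sb_state_after T B y n.
Proof.
elim: n => //= n IH xy; rewrite IH; last first.
  by move=> k t /andP[t1 tn]; apply: xy; rewrite t1 ltnW.
rewrite /sb_step; case: (if _ is [::] then _ else _) => h [|k r] //=.
by rewrite xy// leqnn.
Qed.

(** Predictability: only observations before [t] have to be measurable, the others being replaced by
    0. This allows the sigma-algebra of the past to be used on [Omega]. *)
Lemma measurable_sb_arm (R : realType) (d : measure_display)
    (Omega : measurableType d) (K T : nat) (B : R)
    (x : 'I_K -> nat -> Omega -> R) t k :
  (forall k s, (1 <= s < t)%N -> measurable_fun setT (x k s)) ->
  measurable_fun setT (fun w => sb_arm T B (fun k s => x k s w) t == Some k).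
Proof.
move=> mx.
pose y k s : Omega -> R := if (1 <= s < t)%N then x k s else cst 0.
have my j s : measurable_fun setT (y j s).
  by rewrite /y; case: ifP => [st|_]; [exact: mx|exact: measurable_cst].
apply: (measurable_fun_bool true).
rewrite setTI [X in measurable X](_ : _ =
  [set w | sb_arm T B (fun k s => y k s w) t = Some k]).
  exact: measurable_sb_arm_all.
have yE w : sb_arm T B (fun k s => x k s w) t = sb_arm T B (fun k s => y k s w) t.
  rewrite /sb_arm (@eq_sb_state_after _ _ _ _ _ (fun k s => y k s w)).
    by rewrite /sb_step; case: (if _ is [::] then _ else _) => h [].
  by move=> j s st; rewrite /y; have -> : (1 <= s < t)%N by lia.
by apply/seteqP; split => w /=; rewrite yE => /eqP.
Qed.

(** * Windows of pulls and the exponential process *)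

Section Selection.
Context (R : realType) (K T : nat) (B : R).
Implicit Types (x : 'I_K -> nat -> R) (k : 'I_K).

(** The indices [a <= s < b] stand for the times after [a] up to and including [b]; all windows
    below follow this convention. *)
Definition pulls x k (a b : nat) : nat :=
  (\sum_(a <= s < b) (sb_arm T B x s.+1 == Some k))%N.

(* Time [s.+1] is one of the first [n] pulls of [k] after time [a].  Windows
   are cut by a number of pulls rather than by their end time so that the
   deviation threshold is deterministic and a union over [K * T ^ 2] windows
   suffices. *)
Definition selected x k (a n s : nat) : bool :=
  [&& (a <= s)%N, sb_arm T B x s.+1 == Some k & (pulls x k a s < n)%N].

Lemma pulls_recr x k a b : (a <= b)%N ->
  pulls x k a b.+1 = (pulls x k a b + (sb_arm T B x b.+1 == Some k))%N.
Proof. by move=> ab; rewrite /pulls big_nat_recr. Qed.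

Lemma pulls_geq x k a b : (b <= a)%N -> pulls x k a b = 0%N.
Proof. by move=> ba; rewrite /pulls big_geq. Qed.

Lemma leq_pulls x k a b c : (b <= c)%N -> (pulls x k a b <= pulls x k a c)%N.
Proof.
move=> bc; have [ab|/ltnW ba] := leqP a b; last by rewrite pulls_geq.
by rewrite /pulls (@big_cat_nat _ _ _ b a c)//= leq_addr.
Qed.

Lemma sum_selected_le x k a n t : (\sum_(0 <= s < t) selected x k a n s <= n)%N.
Proof.
(* The bound [n] alone is not inductive; with the minimum, a newly selected time finds the number of
   pulls still below [n]. *)
suff : (\sum_(0 <= s < t) selected x k a n s <= minn n (pulls x k a t))%N.
  by rewrite leq_min => /andP[].
elim: t => [|t IH]; first by rewrite big_geq.
rewrite big_nat_recr//=; move: IH; set S := bigop _ _ _ => IH.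
rewrite /selected; have [at_|ta] := leqP a t; last first.
  rewrite addn0; apply: leq_trans IH _.
  by rewrite (pulls_geq _ _ (ltnW ta)) minn0.
rewrite (pulls_recr _ _ at_) /=.
case: (sb_arm _ _ _ _ == _) => /=; last by rewrite !addn0.
by have [pn|pn] := ltnP (pulls x k a t) n; rewrite /= ?addn0 ?addn1; lia.
Qed.

(** Cutting at the number of pulls that a window contains recovers this window exactly, which
    carries deviation bounds for fixed [n] over to windows with a random number of pulls. *)
Lemma sum_selected_window x k a b t (v : nat -> R) :
  (a <= b <= t)%N ->
  \sum_(0 <= s < t) (if selected x k a (pulls x k a b) s then v s else 0) =
  \sum_(a <= s < b) (if sb_arm T B x s.+1 == Some k then v s else 0).
Proof.
move=> /andP[ab bt].
rewrite (@big_cat_nat _ _ _ a) ?(leq_trans ab bt)//= (@big_cat_nat _ _ _ b a t)//=.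
rewrite big_nat_cond big1 ?add0r; last first.
  move=> s /andP[/andP[_ sa] _].
  by rewrite /selected leqNgt sa.
rewrite [X in _ + X]big_nat_cond [X in _ + X]big1 ?addr0; last first.
  move=> s /andP[/andP[bs _] _].
  by rewrite /selected [(_ < _)%N]ltnNge leq_pulls// !andbF.
apply: eq_big_nat => s /andP[as_ sb].
rewrite /selected as_ /=; case: eqP => //= ks.
suff -> : (pulls x k a s < pulls x k a b)%N by [].
have : (pulls x k a s.+1 <= pulls x k a b)%N by exact: leq_pulls.
by rewrite pulls_recr// ks eqxx addn1.
Qed.

Variable D : 'I_K -> nat -> R.

Definition exp_mart x k a n (l : R) t : R :=
  \prod_(0 <= s < t) (if selected x k a n s
    then expR (l * (- x k s.+1 - D k s.+1) - l ^+ 2 / 8) else 1).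

Lemma exp_mart_ge0 x k a n l t : 0 <= exp_mart x k a n l t.
Proof. by apply: prodr_ge0 => s _; case: ifP => // _; exact: expR_ge0. Qed.

Definition dev x k a n t : R :=
  \sum_(0 <= s < t) (if selected x k a n s then - x k s.+1 - D k s.+1 else 0).

Lemma exp_mart_ge x k a n l t :
  expR (l * dev x k a n t - l ^+ 2 / 8 * n%:R) <= exp_mart x k a n l t.
Proof.
have -> : exp_mart x k a n l t = expR (l * dev x k a n t -
    l ^+ 2 / 8 * (\sum_(0 <= s < t) selected x k a n s)%N%:R).
  rewrite /exp_mart /dev; elim: t => [|t IH].
    by rewrite !big_geq// !mulr0 subr0 expR0.
  rewrite !big_nat_recr//= IH; case: selected => /=.
    by rewrite -expRD natrD; congr expR; ring.
  by rewrite mulr1 addr0 addn0.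
(* Fewer than [n] times may be selected before [t], hence an inequality only. *)
rewrite ler_expR lerB// ler_wpM2l ?ler_nat ?sum_selected_le//.
by rewrite divr_ge0// sqr_ge0.
Qed.

Section Measurable.
Context (d : measure_display) (Omega : measurableType d).
Variables (X : 'I_K -> nat -> Omega -> R) (t : nat).
Hypothesis mX : forall k s, (1 <= s <= t)%N -> measurable_fun setT (X k s).
Let x w : 'I_K -> nat -> R := fun k s => X k s w.

Lemma measurable_selected k a n s : (s <= t)%N ->
  measurable_fun setT (fun w => selected (x w) k a n s).
Proof.
move=> st; have marm r : (r <= s)%N ->
    measurable_fun setT (fun w => sb_arm T B (x w) r.+1 == Some k).
  by move=> rs; apply: measurable_sb_arm => j r' r'r; apply: mX; lia.
apply: measurable_and; first exact: measurable_cst.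
apply: measurable_and; first exact: marm.
(* The threshold [m] is generalised because a pull lowers it by one in the induction on [b]. *)
have mb b : (b <= s)%N -> forall m,
    measurable_fun setT (fun w => pulls (x w) k a b < m)%N.
  elim: b => [|b IH] bs m.
    by under eq_fun do rewrite pulls_geq//; exact: measurable_cst.
  have [ab|ba] := leqP a b; last first.
    by under eq_fun do rewrite pulls_geq//; exact: measurable_cst.
  under eq_fun do rewrite pulls_recr//.
  rewrite (_ : (fun _ => _) = (fun w => if sb_arm T B (x w) b.+1 == Some k
    then (pulls (x w) k a b < m.-1) else (pulls (x w) k a b < m))%N); last first.
    by apply/funext => w; case: eqP => _ /=; case: m => [|m]; lia.
  by apply: measurable_fun_ifT; [apply: marm; lia|apply: IH; lia..].
exact: mb.
Qed.

Lemma measurable_exp_mart k a n l :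
  measurable_fun setT (fun w => exp_mart (x w) k a n l t).
Proof.
apply: measurable_prod => s; rewrite mem_index_iota => st.
apply: measurable_fun_ifT => //; first by apply: measurable_selected; lia.
apply: measurableT_comp => //; apply: measurable_funB => //.
apply: measurable_funM => //; apply: measurable_funB => //.
by apply: measurableT_comp => //; apply: mX; lia.
Qed.

Lemma measurable_dev k a n : measurable_fun setT (fun w => dev (x w) k a n t).
Proof.
have H u : (u <= t)%N -> measurable_fun setT (fun w => dev (x w) k a n u).
  rewrite /dev; elim: u => [|u IH] ut.
    by under eq_fun do rewrite big_geq//; exact: measurable_cst.
  under eq_fun do rewrite big_nat_recr//=.
  apply: measurable_funD; first by apply: IH; lia.
  apply: measurable_fun_ifT => //; first by apply: measurable_selected; lia.
  apply: measurable_funB => //.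
  by apply: measurableT_comp => //; apply: mX; lia.
exact: H.
Qed.

End Measurable.
End Selection.

(** * Concentration and the union bound *)

Section Deviations.
Context (R : realType) (d : measure_display) (Omega : measurableType d)
  (P : probability Omega R).
Variables (K T : nat) (B : R) (X : 'I_K -> nat -> Omega -> R)
  (D : 'I_K -> nat -> R).
Hypothesis mX : forall k t, (1 <= t <= T)%N -> measurable_fun setT (X k t).
Hypothesis indX :
  mutually_independent P (fun p : 'I_K * 'I_T => X p.1 (nat_of_ord p.2).+1).
Hypothesis X01 : forall k t w, (1 <= t <= T)%N -> 0 <= - X k t w <= 1.
Hypothesis EX : forall k t, (1 <= t <= T)%N -> ('E_P[X k t] = (- D k t)%:E)%E.

Let x w : 'I_K -> nat -> R := fun k s => X k s w.

(** A pi-system that generates the sigma-algebra of the observations at times 1, ..., [t]; the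
    component [p.2] encodes time [p.2.+1]. *)
Definition cylinder (t : nat) : set (set Omega) :=
  [set A | exists C : 'I_K * 'I_T -> set R,
    (forall p, measurable (C p)) /\
    A = \big[setI/setT]_(p in [set p : 'I_K * 'I_T | (p.2 < t)%N]%SET)
          (X p.1 (nat_of_ord p.2).+1 @^-1` C p)].

Lemma cylinder_setI t : setI_closed (cylinder t).
Proof.
move=> _ _ [C [mC ->]] [C' [mC' ->]].
exists (fun p => C p `&` C' p); split; first by move=> p; exact: measurableI.
by rewrite -big_split.
Qed.

Lemma cylinder_setT t : cylinder t setT.
Proof.
by exists (fun=> setT); split => //; rewrite big1// => p _; rewrite preimage_setT.
Qed.

Lemma cylinder_measurable t : cylinder t `<=` measurable.
Proof.
move=> _ [C [mC ->]]; apply: bigsetI_measurable => p _.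
rewrite -[X in measurable X]setTI; apply: mX => //.
by have := ltn_ord p.2; lia.
Qed.

Lemma cylinder_preimage t k s C : (1 <= s <= T)%N -> (s <= t)%N ->
  measurable C -> cylinder t (X k s @^-1` C).
Proof.
case: s => // s /= sT st mC.
pose p0 : 'I_K * 'I_T := (k, Ordinal sT).
exists (fun p => if p == p0 then C else setT); split.
  by move=> p; case: ifP.
rewrite (bigD1 p0) ?inE//= eqxx big1 ?setIT//.
by move=> p /andP[_ /negbTE ->]; rewrite preimage_setT.
Qed.

(** Mutual independence is used twice, for the past coordinates [J] and for [J] enlarged by the
    coordinate [p0] of arm [k] at time [t.+1]. *)
Lemma cylinder_indep t k A C : (t < T)%N -> cylinder t A -> measurable C ->
  (P (A `&` X k t.+1 @^-1` C) = P A * P (X k t.+1 @^-1` C))%E.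
Proof.
move=> tT [C' [mC' ->]] mC.
pose p0 : 'I_K * 'I_T := (k, Ordinal tT).
set J := [set p : 'I_K * 'I_T | (p.2 < t)%N]%SET.
have p0J : p0 \notin J by rewrite inE /= ltnn.
pose C2 p := if p == p0 then C else C' p.
have JC2 p : p \in J -> C2 p = C' p.
  by rewrite /C2; case: eqP => // ->; rewrite (negbTE p0J).
have mC2 p : measurable (C2 p) by rewrite /C2; case: ifP.
have -> : \big[setI/setT]_(p in J) (X p.1 (nat_of_ord p.2).+1 @^-1` C' p) =
    \big[setI/setT]_(p in J) (X p.1 (nat_of_ord p.2).+1 @^-1` C2 p).
  by apply: eq_bigr => p pJ; rewrite JC2.
have C2p0 : C2 p0 = C by rewrite /C2 eqxx.
have := indX (p0 |: J)%SET mC2; rewrite !big_setU1//= C2p0 setIC => ->.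
by rewrite muleC [in RHS]indX.
Qed.

Lemma mean_loss k t : (1 <= t <= T)%N ->
  (\int[P]_w (- X k t w)%:E = (D k t)%:E)%E.
Proof.
move=> tT; apply: oppe_inj; rewrite -EFinN -EX// unlock -integral_ge0N.
  by apply: eq_integral => w _; rewrite -EFinN opprK.
by move=> w _; rewrite lee_fin; case/andP: (X01 k w tT).
Qed.

Lemma mean_loss01 k t : (1 <= t <= T)%N -> 0 <= D k t <= 1.
Proof.
move=> tT; apply: integral_01 (mean_loss k tT); last by move=> w; exact: X01.
by apply: measurableT_comp => //; exact: mX.
Qed.

(** Induction on [t]: whether time [t.+1] is selected is known from the past, and the new factor is
    independent of the past with integral at most 1. *)
Lemma exp_mart_le1 k a n l t : (t <= T)%N ->
  (\int[P]_w (exp_mart T B D (x w) k a n l t)%:E <= 1)%E.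
Proof.
elim: t => [|t IH] tT.
  under eq_integral do rewrite /exp_mart big_geq//.
  by rewrite integral_cst_probability.
apply: le_trans (IH (ltnW tT)).
pose OG : measurableType (cylinder t).-sigma := g_sigma_algebraType (cylinder t).
have mXG j s : (1 <= s <= t)%N -> measurable_fun setT (X j s : OG -> R).
  move=> st _ C mC; rewrite setTI; apply: sub_sigma_algebra.
  by apply: cylinder_preimage => //; lia.
have mW := @measurable_exp_mart R K T B D _ OG X t mXG k a n l.
have ms := @measurable_selected R K T B _ OG X t mXG k a n t (leqnn t).
pose W (w : OG) := exp_mart T B D (x w) k a n l t.
pose s (w : OG) := selected T B (x w) k a n t.
have W0 w : 0 <= W w by exact: exp_mart_ge0.
pose g (y : R) := expR (l * (- y - D k t.+1) - l ^+ 2 / 8).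
have toP (h : Omega -> R) : measurable_fun setT (h : OG -> R) ->
    measurable_fun setT h.
  move=> mh _ C mC; rewrite setTI.
  apply: (measurable_sub_sigma (@cylinder_measurable t)).
  by have := mh measurableT C mC; rewrite setTI.
have mWs : measurable_fun setT (fun w => if s w then W w else 0).
  exact: measurable_fun_ifT.
have mWns : measurable_fun setT (fun w => if s w then 0 else W w).
  exact: measurable_fun_ifT.
have Ws0 w : (0 <= (if s w then W w else 0)%:E)%E by rewrite lee_fin; case: ifP.
have Wns0 w : (0 <= (if s w then 0 else W w)%:E)%E by rewrite lee_fin; case: ifP.
have mg : measurable_fun setT g.
  apply: measurableT_comp => //; apply: measurable_funB => //.
  by apply: measurable_funM => //; apply: measurable_funB.
have tT1 : (1 <= t.+1 <= T)%N by [].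
(* Split on the selection of time [t.+1]; without it the new factor is 1. *)
have -> : (\int[P]_w (exp_mart T B D (x w) k a n l t.+1)%:E =
   \int[P]_w (if s w then 0 else W w)%:E +
   \int[P]_w ((if s w then W w else 0)%:E * (g (X k t.+1 w))%:E))%E.
  rewrite -ge0_integralD//.
  - apply: eq_integral => w _; rewrite /exp_mart big_nat_recr//=.
    rewrite -/(exp_mart T B D (x w) k a n l t) -/(W w) -/(s w) -EFinM -EFinD.
    by congr EFin; case: (s w); rewrite ?mulr1 ?mul0r ?add0r ?addr0.
  - exact/measurable_EFinP/toP.
  - by move=> w _; rewrite mule_ge0// lee_fin expR_ge0.
  - apply: emeasurable_funM; first exact/measurable_EFinP/toP.
    by apply/measurable_EFinP/measurableT_comp => //; exact: mX.
rewrite (@expectation_indepM _ _ _ P (cylinder t) (X k t.+1) _ _ _ _ _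
   (fun w => (if s w then W w else 0)%:E) (EFin \o g)) //; last 8 first.
- exact: cylinder_setI.
- exact: cylinder_setT.
- exact: cylinder_measurable.
- exact: mX.
- by move=> A C cA mC; exact: cylinder_indep.
- exact/measurable_EFinP.
- exact/measurable_EFinP.
- by move=> y; rewrite lee_fin expR_ge0.
have Eg : (\int[P]_w (EFin \o g) (X k t.+1 w) <= 1)%E.
  apply: (@hoeffding_mgf R _ _ P (fun w => - X k t.+1 w)).
  - by apply: measurableT_comp => //; exact: mX.
  - by move=> w; exact: X01.
  - exact: mean_loss.
apply: (@le_trans _ _ (\int[P]_w (if s w then 0 else W w)%:E +
    \int[P]_w (if s w then W w else 0)%:E)%E).
  apply: leeD => //; rewrite -[leRHS]mule1; apply: lee_wpmul2l => //.
  exact: integral_ge0.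
rewrite -ge0_integralD//; [|exact/measurable_EFinP/toP..].
rewrite le_eqVlt; apply/orP; left; apply/eqP; apply: eq_integral => w _.
by rewrite -EFinD; congr EFin; rewrite /W; case: (s w); rewrite ?add0r ?addr0.
Qed.

Lemma measurable_dev_gt k a n t (sg : bool) (c : R) : (t <= T)%N ->
  measurable [set w | c < (-1) ^+ sg * dev T B D (x w) k a n t].
Proof.
move=> tT; rewrite -[X in measurable X]setTI.
apply: (@measurable_fun_ltr _ _ _ setT (cst c)
  (fun w => (-1) ^+ sg * dev T B D (x w) k a n t) _ _ measurableT [set true]) => //.
apply: measurable_funM => //; apply: measurable_dev => j s st.
by apply: mX; lia.
Qed.

(** Chernoff's method: Markov's inequality for [exp_mart], whose integral is at most 1. *)
Lemma dev_tail k a n t (L : R) (sg : bool) : (0 < n)%N -> 0 < L -> (t <= T)%N ->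
  (P [set w | Num.sqrt (n%:R * L / 2) < (-1) ^+ sg * dev T B D (x w) k a n t]%R
     <= (expR (- L))%:E)%E.
Proof.
move=> n0 L0 tT.
have n0' : 0 < n%:R :> R by rewrite ltr0n.
set s0 := Num.sqrt _; set E := [set w | _].
have s02 : s0 ^+ 2 = n%:R * L / 2.
  by rewrite sqr_sqrtr// !mulr_ge0// ltW.
have s0_ge0 : 0 <= s0 by exact: sqrtr_ge0.
have mXt k' s : (1 <= s <= t)%N -> measurable_fun setT (X k' s).
  by move=> st; apply: mX; lia.
have mE : measurable E by exact: measurable_dev_gt.
(* The value [4 * s0 / n] maximises l s0 - l^2 n / 8, with maximum 2 s0^2 / n = L; the sign selects
   the tail. *)
pose l := (-1) ^+ sg * (4 * s0 / n%:R).
have EW w : E w -> expR L <= exp_mart T B D (x w) k a n l t.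
  move=> Ew; apply: le_trans (exp_mart_ge _ _ _ _ _ _ _ _ _); rewrite ler_expR.
  have -> : l * dev T B D (x w) k a n t =
      4 / n%:R * (s0 * ((-1) ^+ sg * dev T B D (x w) k a n t)).
    by rewrite /l; field; rewrite gt_eqF.
  have -> : l ^+ 2 / 8 * n%:R = L.
    rewrite /l exprMn sqrr_sign mul1r !exprMn s02.
    by field; rewrite gt_eqF.
  rewrite lerBrDr.
  have -> : L + L = 4 / n%:R * s0 ^+ 2 by rewrite s02; field; rewrite gt_eqF.
  by apply: ler_wpM2l; rewrite ?divr_ge0 ?ler0n// expr2 ler_wpM2l// ltW.
have : ((expR L)%:E * P E <= 1)%E.
  apply: le_trans (exp_mart_le1 k a n l tT).
  have mi : measurable_fun setT (fun w => (\1_E w)%:E : \bar R).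
    exact/measurable_EFinP/measurable_indic.
  rewrite -[X in (_ * P X)%E]setIT -integral_indic//.
  rewrite -ge0_integralZl// ?lee_fin ?expR_ge0//.
  apply: ge0_le_integral => //.
  - exact: emeasurable_funM.
  - by apply/measurable_EFinP; exact: measurable_exp_mart.
  - move=> w _; rewrite -EFinM lee_fin indicE.
    have [/set_mem wE|_] := boolP (w \in E); first by rewrite mulr1; exact: EW.
    by rewrite mulr0 exp_mart_ge0.
by rewrite -lee_pdivlMl ?expR_gt0// expRN mule1.
Qed.

Definition deviating (L : R) : set Omega :=
  \big[setU/set0]_(i : 'I_K * 'I_T * 'I_T * bool)
    [set w | Num.sqrt (i.1.2.+1%:R * L / 2) <
      (-1) ^+ i.2 * dev T B D (x w) i.1.1.1 i.1.1.2 i.1.2.+1 T]%R.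

Lemma measurable_deviating L : measurable (deviating L).
Proof.
by apply: bigsetU_measurable => i _; exact: measurable_dev_gt.
Qed.

(** There are [K * T * T * 2] indices, each contributing at most [expR (- L)] by [dev_tail]. *)
Lemma probability_deviating L : 0 < L ->
  (P (deviating L) <= ((2 * K%:R * T%:R ^+ 2) * expR (- L))%:E)%E.
Proof.
move=> L0; rewrite /deviating.
pose F (i : 'I_K * 'I_T * 'I_T * bool) :=
  [set w | Num.sqrt (i.1.2.+1%:R * L / 2) <
      (-1) ^+ i.2 * dev T B D (x w) i.1.1.1 i.1.1.2 i.1.2.+1 T]%R.
apply: (@le_trans _ _ (\sum_(i : 'I_K * 'I_T * 'I_T * bool) P (F i))%E).
  have mF i : measurable (F i) by exact: measurable_dev_gt.
  rewrite -/F; elim: (index_enum _) => [|i r IH]; first by rewrite !big_nil measure0.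
  rewrite !big_cons; apply: le_trans (leeD2l (P (F i)) IH).
  apply: measureU2; first exact: mF.
  by apply: bigsetU_measurable => j _; exact: mF.
apply: (@le_trans _ _ (\sum_(i : 'I_K * 'I_T * 'I_T * bool) (expR (- L))%:E)%E).
  by apply: lee_sum => i _; exact: dev_tail.
rewrite sumEFin lee_fin sumr_const -[leLHS]mulr_natl.
by rewrite !card_prod !card_ord card_bool !natrM; lra.
Qed.

End Deviations.

(** * The regret over a window of times *)

Definition regret (R : realType) (K T : nat) (B : R) (x : 'I_K -> nat -> R)
    (D : 'I_K -> nat -> R) (a b : nat) : R :=
  \sum_(a <= s < b) (if sb_arm T B x s.+1 is Some k then D k s.+1 else 0).

Lemma regretE (R : realType) (K T : nat) (B : R) (x : 'I_K -> nat -> R)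
    (D : 'I_K -> nat -> R) a b :
  regret T B x D a b = \sum_k
    \sum_(a <= s < b) (if sb_arm T B x s.+1 == Some k then D k s.+1 else 0).
Proof.
rewrite exchange_big; apply: eq_bigr => s _ /=.
case: (sb_arm _ _ _ _) => [k|]; last by rewrite big1.
rewrite (bigD1 k)//= eqxx big1 ?addr0// => j jk.
by case: eqP => // -[kj]; rewrite kj eqxx in jk.
Qed.

Lemma regret_bounds (R : realType) (K T : nat) (B : R) (x : 'I_K -> nat -> R)
    (D : 'I_K -> nat -> R) t :
  (forall k s, (1 <= s <= t)%N -> 0 <= D k s <= 1) ->
  0 <= regret T B x D 0 t <= t%:R.
Proof.
rewrite /regret; elim: t => [|t IH] D01; first by rewrite big_geq// lexx.
rewrite big_nat_recr//= -natr1.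
have /IH : forall k s, (1 <= s <= t)%N -> 0 <= D k s <= 1.
  by move=> k s st; apply: D01; lia.
have : 0 <= (if sb_arm T B x t.+1 is Some k then D k t.+1 else 0) <= 1.
  case: (sb_arm _ _ _ _) => [k|]; last by rewrite lexx ler01.
  by apply: D01; lia.
by set u := \sum_(_ <= _ < _) _; set v := if _ is Some _ then _ else _; lra.
Qed.

Lemma measurable_regret (R : realType) (d : measure_display)
    (Omega : measurableType d) (K T : nat) (B : R)
    (X : 'I_K -> nat -> Omega -> R) (D : 'I_K -> nat -> R) t :
  (forall k s, (1 <= s <= t)%N -> measurable_fun setT (X k s)) ->
  measurable_fun setT (fun w => regret T B (fun k s => X k s w) D 0 t).
Proof.
move=> mX; under eq_fun do rewrite regretE.
apply: measurable_sum => k; under eq_fun do rewrite big_mkord.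
apply: measurable_sum => s; apply: measurable_fun_ifT => //.
apply: measurable_sb_arm => j r rs; apply: mX.
by have := ltn_ord s; lia.
Qed.

(** * Deterministic regret bound on the good event *)

Section Regret.
Context (R : realType) (K T : nat) (B : R).
Variables (x : 'I_K -> nat -> R) (D : 'I_K -> nat -> R).

Let th : R := Num.max (Num.sqrt T%:R)^-1 B.
Let L : R := ln (2 * K%:R * T%:R ^+ 3).
Let arm := sb_arm T B x.
Let np := pulls T B x.

Hypothesis th0 : 0 < th.
Hypothesis L0 : 0 < L.
Hypothesis x01 : forall k t, (1 <= t <= T)%N -> 0 <= - x k t <= 1.
Hypothesis good : forall k a n (sg : bool), (a < T)%N -> (0 < n <= T)%N ->
  (-1) ^+ sg * dev T B D x k a n T <= Num.sqrt (n%:R * L / 2).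

Let win (v : 'I_K -> nat -> R) k a b : R :=
  \sum_(a <= s < b) (if arm s.+1 == Some k then v k s.+1 else 0).
Let loss k a b := win (fun k t => - x k t) k a b.

(** The elimination threshold after [n] pulls, multiplied by [n], so that it is compared with
    cumulative losses. *)
Let bnd (n : nat) : R := 2 * th * n%:R + Num.sqrt (n%:R * L / 2).

Lemma bnd_ge0 n : 0 <= bnd n.
Proof. by rewrite addr_ge0 ?sqrtr_ge0// !mulr_ge0// ltW. Qed.

Lemma le_bnd m n : (m <= n)%N -> bnd m <= bnd n.
Proof.
move=> mn; apply: lerD; first by rewrite ler_pM2l ?ler_nat// mulr_gt0.
by rewrite ler_sqrt ?ler_pM2r ?ler_nat ?invr_gt0// !mulr_ge0// ltW.
Qed.

Lemma win_recr v k a b : (a <= b)%N ->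
  win v k a b.+1 = win v k a b + (if arm b.+1 == Some k then v k b.+1 else 0).
Proof. by move=> ab; rewrite /win big_nat_recr. Qed.

Lemma win_le v k a b (c : R) :
  (forall s, (a <= s < b)%N -> arm s.+1 = Some k -> v k s.+1 <= c) ->
  win v k a b <= c * (np k a b)%:R.
Proof.
move=> vc; rewrite /win /np /pulls natr_sum mulr_sumr.
rewrite big_nat_cond [leRHS]big_nat_cond; apply: ler_sum => s /andP[sab _].
rewrite -/arm; case: eqP => [k_s|_]; last by rewrite mulr0.
by rewrite mulr1; exact: vc.
Qed.

Lemma loss_le_pulls k a b : (b <= T)%N -> loss k a b <= (np k a b)%:R.
Proof.
move=> bT; rewrite -[leRHS]mul1r; apply: win_le => s sab _.
by have /andP[] : 0 <= - x k s.+1 <= 1 by apply: x01; lia.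
Qed.

Lemma good_window k a b (sg : bool) : (a <= b <= T)%N ->
  (-1) ^+ sg * (loss k a b - win D k a b) <= Num.sqrt ((np k a b)%:R * L / 2).
Proof.
move=> /andP[ab bT].
have -> : loss k a b - win D k a b =
    \sum_(a <= s < b) (if arm s.+1 == Some k then - x k s.+1 - D k s.+1 else 0).
  rewrite /loss /win -sumrB; apply: eq_bigr => s _.
  by case: ifP => // _; rewrite subr0.
have pba : (np k a b <= b - a)%N.
  rewrite /np /pulls -[leqRHS]muln1 -sum_nat_const_nat.
  by apply: leq_sum => s _; case: (_ == _).
case p0 : (np k a b) => [|n].
  rewrite mul0r mul0r sqrtr0 big_nat_cond big1 ?mulr0//.
  move=> s /andP[sab _]; case: eqP => // ks.
  move: p0; rewrite /np /pulls => /eqP; rewrite sum_nat_seq_eq0 => /allP.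
  move=> /(_ s); rewrite mem_index_iota sab => /(_ isT) /=.
  by rewrite -/arm ks eqxx.
rewrite -(@sum_selected_window R K T B x k a b T (fun s => - x k s.+1 - D k s.+1)) ?ab//.
rewrite -/(np k a b) p0 -/(dev T B D x k a n.+1 T).
by apply: good; lia.
Qed.

(* The rounds [h] record exactly the pulls at the times [a.+1], ..., [b]. *)
Definition matches (h : seq (round_obs R K)) a b := forall k,
  Tk h k = np k a b /\ \sum_(rd <- h) obs_val (rd k) = - loss k a b.

(** The test is multiplied by the number [n] of pulls, which turns sqrt (L / (2 n)) into sqrt (n L /
    2). With no pull both sides hold. *)
Lemma tildeDelta_eq0 h a b k : (a <= b <= T)%N -> matches h a b ->
  (tildeDelta T B h k == 0) = (loss k a b <= bnd (np k a b)).
Proof.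
move=> /andP[ab bT] /(_ k) [TkE sumE]; rewrite /tildeDelta /hatDelta TkE sumE.
have [p0|p0] := eqVneq (np k a b) 0%N.
  rewrite eqxx; apply/esym/(le_trans (loss_le_pulls k a bT)).
  by rewrite p0; exact: bnd_ge0.
set n := np k a b in p0 *.
have n0 : 0 < n%:R :> R by rewrite ltr0n lt0n.
rewrite -/L -/th eq_maxr mulNr opprK.
have -> : Num.sqrt (L / (2 * n%:R)) = Num.sqrt (n%:R * L / 2) / n%:R.
  apply/esym/eqP; rewrite -(@eqrXn2 _ 2) ?divr_ge0 ?sqrtr_ge0 ?ler0n//.
  rewrite exprMn exprVn !sqr_sqrtr; last 2 first.
  - by rewrite divr_ge0 ?mulr_ge0 ?ler0n// ltW.
  - by rewrite !mulr_ge0 ?ler0n ?invr_ge0// ltW.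
  by apply/eqP; field; rewrite gt_eqF.
rewrite -(ler_pM2l n0) mulr0 /bnd -/n -[RHS]subr_le0; congr (_ <= _).
by field; rewrite gt_eqF.
Qed.

(** * The invariant of an episode *)

Definition refresh (st : sb_state R K) : sb_state R K :=
  if sb_rem st is [::] then
    let: (h, r) := new_round T B st in SBState h (@empty_round R K) r
  else st.

Definition pull t (st : sb_state R K) : option 'I_K * sb_state R K :=
  if sb_rem st is k :: r then
    (Some k, SBState (sb_hist st)
      (fun j => if j == k then Some (x k t) else sb_cur st j) r)
  else (None, st).

(** Separating the closing of a round from the pull lets the invariant be followed through each of
    them in turn. *)
Lemma sb_stepE t st : sb_step T B x t st = pull t (refresh st).
Proof.
rewrite /sb_step /refresh /pull; case: st => h c [|k r] //=.
by case: new_round => h' [|k r].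
Qed.

(* [a] is the time at which the current episode started. *)
Definition invariant (st : sb_state R K) a t : Prop :=
  [/\ forall j, (j <= size (sb_hist st))%N ->
        exists2 b, (a <= b <= t)%N & matches (take j (sb_hist st)) a b,
      matches (rcons (sb_hist st) (sb_cur st)) a t,
      uniq (sb_rem st) /\ forall k, k \in sb_rem st -> sb_cur st k = None,
      forall k, k \in sb_rem st -> loss k a t <= bnd (np k a t) &
      forall k, loss k a t <= bnd (np k a t) + 1].

Lemma matches_refl a : matches [::] a a.
Proof.
by move=> k; rewrite /loss /win /np /pulls !big_geq// big_nil oppr0.
Qed.

Lemma matches_empty h a b : matches h a b ->
  matches (rcons h (@empty_round R K)) a b.
Proof.
move=> m k; have [<- <-] := m k.
by rewrite /Tk -cats1 count_cat /= !addn0 big_cat big_seq1 /= addr0.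
Qed.

Lemma invariant_new a r : uniq r -> invariant (SBState [::] (@empty_round R K) r) a a.
Proof.
move=> ur; split => //=.
- by move=> j _; exists a; rewrite ?leqnn//; exact: matches_refl.
- by have := matches_empty (matches_refl a).
- by move=> k _; rewrite /loss /win big_geq// bnd_ge0.
- by move=> k; rewrite /loss /win big_geq// addr_ge0// bnd_ge0.
Qed.

Lemma invariant_pull st a t : (a <= t < T)%N -> arm t.+1 = (pull t.+1 st).1 ->
  invariant st a t -> invariant (pull t.+1 st).2 a t.+1.
Proof.
move=> /andP[at_ tT]; rewrite /pull; case: st => h c [|k r] /= armE.
  have pE j : np j a t.+1 = np j a t.
    by rewrite /np pulls_recr// -/arm armE addn0.
  have lE j : loss j a t.+1 = loss j a t by rewrite /loss win_recr// armE addr0.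
  move=> [/= Ih m u r1 r2]; split => //=.
  - by move=> j /Ih[b bt mb]; exists b => //; lia.
  - by move=> j; rewrite pE lE; exact: m.
  - by move=> j; rewrite pE lE.
have pE j : np j a t.+1 = (np j a t + (j == k))%N.
  by rewrite /np pulls_recr// -/arm armE; congr (_ + _)%N; rewrite eq_sym.
have lE j : loss j a t.+1 = loss j a t + (if j == k then - x k t.+1 else 0).
  rewrite /loss win_recr// armE (eq_sym j k).
  by have [->|kj] := eqVneq k j; rewrite ?eqxx// ifN//; apply: contra kj => /eqP[->].
move=> [/= Ih m [/andP[kr ur] rN] r1 r2]; split => //=.
- by move=> j /Ih[b bt mb]; exists b => //; lia.
- move=> j; rewrite pE lE; have [] := m j.
  rewrite /Tk -!cats1 !count_cat !big_cat !big_seq1 /= !addn0.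
  have [->|jk] := eqVneq j k; last by rewrite addn0 addr0.
  by rewrite (rN k) ?mem_head//= !addn0 addr0 => -> ->; rewrite addn1 opprD opprK.
- split => // j jr; case: eqP => [jk|_]; first by rewrite -jk jr in kr.
  by apply: rN; rewrite inE jr orbT.
- move=> j jr; rewrite pE lE; have [jk|jk] := eqVneq j k.
    by rewrite -jk jr in kr.
  by rewrite addn0 addr0; apply: r1; rewrite inE jr orbT.
- move=> j; rewrite pE lE; have [->|jk] := eqVneq j k; last by rewrite addn0 addr0.
  apply: lerD; last first.
    by have /andP[] : 0 <= - x k t.+1 <= 1 by apply: x01; lia.
  (* The pulled arm still passed its test just before this pull, and one loss is at most 1: this is
     the excess 1 in the invariant. *)
  apply: le_trans (r1 k _) (le_bnd _); first exact: mem_head.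
  exact: leq_addr.
Qed.

(** Either the episode goes on, or the active set is empty and every arm failed its test on some
    prefix of the history, which matches a window starting at [a]. *)
Lemma invariant_refresh st a t : (a <= t <= T)%N -> invariant st a t ->
  invariant (refresh st) a t \/
  (invariant (refresh st) t t /\
   forall k, exists2 b, (a <= b <= t)%N & bnd (np k a b) < loss k a b).
Proof.
move=> /andP[at_ tT]; case: st => h c [|k r]; last by left.
move=> [/= Ih m _ _ r2]; rewrite /refresh /new_round /=.
have hj j : (j <= size (rcons h c))%N ->
    exists2 b, (a <= b <= t)%N & matches (take j (rcons h c)) a b.
  rewrite size_rcons leq_eqVlt => /predU1P[->|jh].
    by exists t; [lia|rewrite take_oversize// size_rcons].
  have [b bt mb] := Ih j jh; exists b => //.
  by rewrite -cats1 takel_cat.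
case E : (active T B (rcons h c)) => [|k r] /=; last first.
  left; rewrite -E; split => //=.
  - exact: matches_empty.
  - by split => //; rewrite filter_uniq// enum_uniq.
  - move=> j; rewrite mem_filter => /andP[/allP /(_ (size (rcons h c)))] + _.
    rewrite mem_iota leq0n ltnSn take_size => /(_ isT).
    by rewrite (tildeDelta_eq0 _ _ m)// at_.
right; split.
  have [] := @invariant_new t (active T B [:: @empty_round R K]) _.
    by rewrite filter_uniq// enum_uniq.
  move=> _ _ u r1' r2'; split => //=.
  (* The new history is a single empty round, so both of its prefixes match the empty window at
     [t]. *)
  - move=> [|[|j]]//= _; exists t; rewrite ?leqnn//; first exact: matches_refl.
    exact: (matches_empty (matches_refl t)).
  - exact: (matches_empty (matches_empty (matches_refl t))).
move=> k.
have : k \notin active T B (rcons h c) by rewrite E.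
rewrite mem_filter mem_enum andbT => /allPn[j].
rewrite mem_iota leq0n add0n ltnS => /= /hj[b bt mb].
have bT : (a <= b <= T)%N by lia.
by rewrite (tildeDelta_eq0 _ bT mb) -ltNge => ?; exists b.
Qed.

(** * Counting episodes and summing their regret *)

Let reg a b : R := regret T B x D a b.

Lemma sum_pulls_le a b : (\sum_k np k a b <= b - a)%N.
Proof.
rewrite /np /pulls exchange_big -[leqRHS]muln1 -sum_nat_const_nat.
apply: leq_sum => s _ /=; rewrite -/arm.
case: (arm s.+1) => [k|]; last by rewrite big1.
rewrite (bigD1 k)//= eqxx big1// => j jk.
by case: eqP => // -[kj]; rewrite kj eqxx in jk.
Qed.

Variable al : R.
Hypothesis al0 : 0 < al.

(* AM-GM; summing a linear bound over arms and episodes replaces the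
   Cauchy-Schwarz inequality, [al] being optimised at the end. *)
Lemma sqrt_le_linear (n : nat) :
  2 * Num.sqrt (n%:R * L / 2) <= al / 2 * n%:R + L / al.
Proof.
have n0 : 0 <= n%:R :> R by rewrite ler0n.
have A0 : 0 <= al / 2 * n%:R by rewrite !mulr_ge0// ltW.
have B0 : 0 <= L / al by rewrite divr_ge0// ltW.
rewrite -(@ler_pXn2r _ 2)// ?nnegrE ?mulr_ge0 ?sqrtr_ge0 ?addr_ge0//.
rewrite exprMn sqr_sqrtr ?mulr_ge0 ?invr_ge0 ?(ltW L0)//.
have := sqr_ge0 (al / 2 * n%:R - L / al).
have -> : 2 ^+ 2 * (n%:R * L / 2) = 4 * ((al / 2 * n%:R) * (L / al)).
  by field; rewrite gt_eqF.
by set p := al / 2 * _; set q := L / al; rewrite !expr2; lra.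
Qed.

(** For each arm, [good_window] passes from losses to gaps at the cost of a second square root, and
    [sqrt_le_linear] linearises the two together. *)
Lemma regret_episode st a t : (a <= t <= T)%N -> invariant st a t ->
  reg a t <= (2 * th + al / 2) * (t - a)%N%:R + K%:R * (L / al + 1).
Proof.
move=> atT [_ _ _ _ le_loss]; rewrite /reg regretE.
apply: (@le_trans _ _ (\sum_(k < K) ((2 * th + al / 2) * (np k a t)%:R +
    (L / al + 1)))).
  apply: ler_sum => k _; rewrite -[leLHS]/(win D k a t).
  have := le_loss k; have := sqrt_le_linear (np k a t).
  have := good_window k true atT; rewrite expr1 mulN1r opprB /bnd.
  by set r := Num.sqrt _; lra.
rewrite big_split /= sumr_const card_ord -[X in _ + X <= _]mulr_natl lerD2r.
rewrite -mulr_sumr.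
rewrite -natr_sum ler_pM2l ?ler_nat ?sum_pulls_le//.
by rewrite addr_gt0 ?mulr_gt0 ?invr_gt0.
Qed.

Variables (M : nat) (tau : nat -> nat).
Hypotheses (M0 : (0 < M)%N) (tau1 : tau 1%N = 1%N) (tauM : tau M.+1 = T.+1).
Hypothesis argmin : forall t, exists k, D k t = 0.
Hypothesis segment : forall k m t t', (1 <= m <= M)%N ->
  (tau m <= t < tau m.+1)%N -> (tau m <= t' < tau m.+1)%N ->
  D k t' = 0 -> D k t <= 2 * th.

(* On the good event an arm is only eliminated after its gap has exceeded
   [2 * th], whereas within a segment the arm that is optimal at some time
   keeps its gap below [2 * th]. *)
Lemma restart_crosses a t m : (a <= t < T)%N -> (1 <= m <= M)%N ->
  (tau m <= a.+1)%N ->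
  (forall k, exists2 b, (a <= b <= t)%N & bnd (np k a b) < loss k a b) ->
  (tau m.+1 <= t.+1)%N.
Proof.
move=> atT mM ma out; rewrite leqNgt; apply/negP => tm.
have [k Dk] := argmin a.+1.
have [b bt lt_loss] := out k.
have bT : (a <= b <= T)%N by lia.
suff : win D k a b <= 2 * th * (np k a b)%:R.
  have := good_window k false bT; rewrite expr0 mul1r.
  by move: lt_loss; rewrite /bnd; set r := Num.sqrt _; lra.
apply: win_le => s sab _.
by apply: (segment mM _ _ Dk); lia.
Qed.

(** Here [E] counts the completed episodes. Each of them crossed a breakpoint, so segment [E.+1] has
    begun when the current episode starts. *)
Lemma regret_invariant t : (t <= T)%N -> exists a E,
  [/\ (a <= t)%N, invariant (sb_state_after T B x t) a t,
      (E < M)%N, (tau E.+1 <= a.+1)%N &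
      reg 0 a <= (2 * th + al / 2) * a%:R + E%:R * (K%:R * (L / al + 1))].
Proof.
elim: t => [|t IH] tT.
  exists 0%N, 0%N; split => //; last by rewrite /reg /regret big_geq// !(mulr0, mul0r) addr0.
    by apply: invariant_new; exact: enum_uniq.
  by rewrite tau1.
have [a [E [at_ inv EM tauE rega]]] := IH (ltnW tT).
have armE : arm t.+1 = (pull t.+1 (refresh (sb_state_after T B x t))).1.
  by rewrite /arm /sb_arm sb_stepE.
have atT : (a <= t <= T)%N by lia.
rewrite /= sb_stepE.
have [inv'|[inv' out]] := invariant_refresh atT inv.
  by exists a, E; split => //; [lia|apply: invariant_pull => //; lia].
have cross : (tau E.+2 <= t.+1)%N by apply: (restart_crosses _ _ tauE out); lia.
exists t, E.+1; split => //.
- by apply: invariant_pull => //; lia.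
(* If [E.+1] were [M], the breakpoint crossed would be [T.+1], beyond the horizon. *)
- rewrite ltn_neqAle EM andbT; apply/eqP => EM'.
  by move: cross; rewrite EM' tauM; lia.
rewrite /reg /regret (@big_cat_nat _ _ _ a)//=.
apply: le_trans (lerD rega (regret_episode atT inv)) _.
rewrite natrB// -natr1 le_eqVlt; apply/orP; left; apply/eqP; ring.
Qed.

Lemma regret_bound : reg 0 T <=
  (2 * th + al / 2) * T%:R + M%:R * (K%:R * (L / al + 1)).
Proof.
have [a [E [aT inv EM _ rega]]] := regret_invariant (leqnn T).
have aTT : (a <= T <= T)%N by rewrite aT leqnn.
rewrite /reg /regret (@big_cat_nat _ _ _ a)//=.
apply: le_trans (lerD rega (regret_episode aTT inv)) _.
have c0 : 0 <= K%:R * (L / al + 1).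
  by rewrite mulr_ge0// addr_ge0// divr_ge0// ltW.
(* The last, unfinished episode is the additional one. *)
have : E.+1%:R * (K%:R * (L / al + 1)) <= M%:R * (K%:R * (L / al + 1)).
  by rewrite ler_wpM2r// ler_nat.
by rewrite natrB// -natr1; lra.
Qed.

End Regret.

(** * From the good event to the expected regret *)

Lemma gap_eq0 (R : realType) (K T : nat) (f : 'I_K -> R -> R) (t : nat) :
  (0 < K)%N -> exists k, gap T f k t = 0.
Proof.
move=> K0; pose k0 : 'I_K := Ordinal K0.
pose k := [arg max_(j > k0) mu T f j t]%O.
exists k; rewrite /gap /mustar.
suff -> : \big[Order.max/-oo%E]_(j < K) (mu T f j t)%:E = (mu T f k t)%:E.
  by rewrite subrr.
apply/eqP; rewrite eq_le; apply/andP; split; last exact: (le_bigmax _ (fun j => (mu T f j t)%:E)).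
apply: bigmax_le; first exact: leNye.
by move=> j _; rewrite lee_fin /k; case: arg_maxP => // i _ /(_ j isT).
Qed.

Lemma sb_regretE (R : realType) (K T : nat) (f : 'I_K -> R -> R) (B : R)
    (x : 'I_K -> nat -> R) :
  sb_regret T f B x = regret T B x (gap T f) 0 T.
Proof. by rewrite /sb_regret /regret big_add1. Qed.

Theorem theorem2 (R : realType) (d : measure_display) (Omega : measurableType d)
  (P : probability Omega R) (K T M : nat) (Bstar : R)
  (f : 'I_K -> R -> R) (X : 'I_K -> nat -> Omega -> R) :
  (0 < K)%N -> (0 < M)%N -> 0 < Bstar ->
  (* (i) observations: random variables, independent across arms and time,
         -X_{k,t} in [0,1], E X_{k,t} = -Delta_k(t) *)
  (forall k t, (1 <= t <= T)%N -> measurable_fun setT (X k t)) ->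
  mutually_independent P (fun p : 'I_K * 'I_T => X p.1 (nat_of_ord p.2).+1) ->
  (forall k t w, (1 <= t <= T)%N -> 0 <= - X k t w <= 1) ->
  (forall k t, (1 <= t <= T)%N -> ('E_P[X k t] = (- gap T f k t)%:E)%E) ->
  (* (ii) piecewise near-stationarity of the gaps *)
  (exists tau : nat -> nat,
     [/\ tau 1%N = 1%N, tau M.+1 = T.+1,
         (forall m, (1 <= m <= M)%N -> (tau m < tau m.+1)%N) &
         forall (k : 'I_K) (m t t' : nat), (1 <= m <= M)%N ->
           (tau m <= t < tau m.+1)%N -> (tau m <= t' < tau m.+1)%N ->
           (2 `^ (- 4^-1) <= gap T f k t / gap T f k t' <= 2 `^ (4^-1))
           \/ (0 <= gap T f k t <= 2 * Num.max (Num.sqrt T%:R)^-1 Bstar)]) ->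
  forall c : R, 16 <= c ->
  ('E_P[fun w => sb_regret T f Bstar (fun k t => X k t w)] <=
  ((2 `^ (3 / 2) + 2 `^ (2^-1) * c * ln (2 * K%:R * T%:R ^+ 3))
     * Num.sqrt (K%:R * T%:R * M%:R)
   + 2 * K%:R * M%:R + 8 * T%:R * Num.max Bstar (Num.sqrt T%:R)^-1 + 1)%:E)%E.
Proof.
move=> K0 M0 B0 mX indX X01 EX [tau [tau1 tauM tauS seg]] c c16.
have T0 : (0 < T)%N.
  have tau_ge1 m : (m < M)%N -> (0 < tau m.+1)%N.
    case: m => [|m] mM; first by rewrite tau1.
    by apply: leq_trans (tauS m.+1 _); lia.
  have tM1 : (0 < tau M)%N by rewrite -(prednK M0); apply: tau_ge1; lia.
  have : (tau M < tau M.+1)%N by apply: tauS; rewrite M0 leqnn.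
  by rewrite tauM; lia.
rewrite (maxC Bstar).
set L := ln _; set th := Num.max _ Bstar in seg *.
pose D := gap T f; pose x w : 'I_K -> nat -> R := fun k t => X k t w.
have nK0 : 0 < K%:R :> R by rewrite ltr0n.
have nK1 : 1 <= K%:R :> R by rewrite ler1n.
have nT0 : 0 < T%:R :> R by rewrite ltr0n.
have nT1 : 1 <= T%:R :> R by rewrite ler1n.
have nM0 : 0 < M%:R :> R by rewrite ltr0n.
have th0 : 0 < th by rewrite lt_max B0 orbT.
have y0 : 0 < 2 * K%:R * T%:R ^+ 3 :> R by rewrite !mulr_gt0// exprn_gt0.
have L0 : 0 < L.
  apply: ln_gt0; have T31 : 1 <= T%:R ^+ 3 :> R by exact: exprn_ege1.
  have : 1 <= K%:R * T%:R ^+ 3 :> R by exact: mulr_ege1.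
  by rewrite -mulrA; lra.
have D01 k t : (1 <= t <= T)%N -> 0 <= D k t <= 1.
  exact: (@mean_loss01 _ _ _ P K T X D mX X01 EX).
have segment k m t t' : (1 <= m <= M)%N ->
    (tau m <= t < tau m.+1)%N -> (tau m <= t' < tau m.+1)%N ->
    D k t' = 0 -> D k t <= 2 * th.
  (* Division by 0 gives 0, which is below 2^(-1/4), so the ratio alternative fails when the gap at
     [t'] vanishes. *)
  move=> mM tm t'm Dt'; have [|/andP[_ //]] := seg k m t t' mM tm t'm.
  rewrite -/(D k t') Dt' invr0 mulr0 => /andP[+ _].
  by rewrite leNgt powR_gt0.
pose S := Num.sqrt (K%:R * T%:R * M%:R : R).
have S2 : S ^+ 2 = K%:R * T%:R * M%:R by rewrite sqr_sqrtr// !mulr_ge0// ltW.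
have S0 : 0 < S by rewrite sqrtr_gt0 !mulr_gt0.
(* This choice turns [al / 2 * T] into [S / 2] and [K * M * L / al] into [L * S], both within the
   target. *)
pose al := S / T%:R.
have al0 : 0 < al by exact: divr_gt0.
pose b := (2 * th + al / 2) * T%:R + M%:R * (K%:R * (L / al + 1)).
have bE : b = 2 * th * T%:R + S / 2 + L * S + K%:R * M%:R.
  rewrite /b mulrDl /al (_ : S / T%:R / 2 * T%:R = S / 2); last first.
    by field; rewrite gt_eqF.
  rewrite (_ : M%:R * _ = L * (K%:R * T%:R * M%:R / S) + K%:R * M%:R); last first.
    by field; rewrite !gt_eqF.
  by rewrite -S2 expr2 mulfK ?gt_eqF//; ring.
have b0 : 0 <= b.
  by rewrite bE !addr_ge0 ?mulr_ge0// ltW// ?divr_gt0.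
pose bad := deviating T Bstar X D L.
have mbad : measurable bad by exact: measurable_deviating.
pose reg w := regret T Bstar (x w) D 0 T.
have reg_good w : ~ bad w -> reg w <= b.
  move=> nbad; apply: (@regret_bound R K T Bstar (x w) D th0 L0 _ _ al al0 M tau).
  - by move=> k t; exact: X01.
  - move=> k a [|n] sg aT //= nT; rewrite leNgt; apply/negP => dv; apply: nbad.
    pose i : 'I_K * 'I_T * 'I_T * bool := (k, Ordinal aT, Ordinal nT, sg).
    by rewrite /bad /deviating (bigD1 i)//=; left.
  - by [].
  - by [].
  - by [].
  - by move=> t; exact: gap_eq0.
  - exact: segment.
have reg0T w : 0 <= reg w <= T%:R by exact: regret_bounds.
have mreg : measurable_fun setT reg by exact: measurable_regret.
(* Since [expR (- L)] is 1 / (2 K T^3), the union bound gives probability at most 1 / T. *)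
have Pbad : (T%:R%:E * P bad <= 1)%E.
  have le_bad := @probability_deviating _ _ _ P K T Bstar X D mX indX X01 EX L L0.
  apply: le_trans (lee_wpmul2l _ le_bad) _; first by rewrite lee_fin ltW.
  rewrite -EFinM lee_fin expRN lnK ?posrE// le_eqVlt; apply/orP; left; apply/eqP.
  by field; rewrite !gt_eqF.
rewrite unlock.
(* The constants of the claim dominate those of [b] term by term; the final 1 pays for the bad
   event. *)
apply: (@le_trans _ _ (b + 1)%:E); last first.
  have p1 : 1 <= 2 `^ (3 / 2) :> R.
    by rewrite -[leLHS](powRr0 2) ler_powR//; lra.
  have p2 : 1 <= 2 `^ (2^-1) :> R.
    by rewrite -[leLHS](powRr0 2) ler_powR//; lra.
  have cL : L <= 2 `^ 2^-1 * c * L.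
    by rewrite -[leLHS]mul1r ler_pM2r// mulr_ege1//; lra.
  have : (1 + L) * S <= (2 `^ (3 / 2) + 2 `^ 2^-1 * c * L) * S.
    by rewrite ler_pM2r// lerD.
  have KM0 : 0 < K%:R * M%:R :> R by exact: mulr_gt0.
  have thT0 : 0 < th * T%:R by exact: mulr_gt0.
  rewrite lee_fin bE -/S; lra.
have ind0 w : 0 <= \1_bad w :> R by [].
have mind : measurable_fun setT (\1_bad : Omega -> R) by exact: measurable_indic.
have -> : (b + 1)%:E = (\int[P]_w b%:E + 1)%E by rewrite integral_cst_probability.
(* Pointwise, the regret is at most [b] off [bad] and at most [T] on it. *)
apply: (@le_trans _ _ (\int[P]_w b%:E + \int[P]_w (T%:R * \1_bad w)%:E)%E).
  have ind_ge0 w : [set: Omega] w -> (0 <= (T%:R * \1_bad w : R)%:E)%E.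
    by move=> _; rewrite lee_fin mulr_ge0// ltW.
  have mTind : measurable_fun setT (fun w => (T%:R * \1_bad w : R)%:E).
    by apply/measurable_EFinP; exact: measurable_funM.
  rewrite -ge0_integralD//.
  apply: ge0_le_integral => //.
  - by move=> w _; rewrite lee_fin sb_regretE; case/andP: (reg0T w).
  - by under eq_fun do rewrite sb_regretE; exact/measurable_EFinP.
  - by apply/measurable_EFinP; apply: measurable_funD => //; exact: measurable_funM.
  - move=> w _; rewrite sb_regretE -EFinD lee_fin indicE.
    have [_|/negP wb] := boolP (w \in bad).
      by rewrite mulr1; apply: le_trans (proj2 (andP (reg0T w))) _; rewrite lerDr.
    by rewrite mulr0 addr0; apply: reg_good => /mem_set.
rewrite leeD2l//.
under eq_integral do rewrite EFinM.
have mEind : measurable_fun setT (fun w => (\1_bad w : R)%:E).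
  exact/measurable_EFinP.
by rewrite ge0_integralZl// ?lee_fin ?ler0n// integral_indic// setIT.
Qed.
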